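(* Let $V,H$ be (real) Hilbert spaces with $V$ densely and compactly embedded in $H$, let $X$ be a (real) Banach space, $D\subseteq X$ an open convex set and $S\subseteq D$ a nonempty convex set. Let $A:D\to\mathscr{B}_s(V,V)$ and $B:D\to\mathscr{B}_s(H,H)$ be maps such that: (i) (ellipticity and boundedness) there are constants $0<\underline a<\overline a$ and $0<\underline b<\overline b$ such that for all $u\in V$ and all $\theta\in D$, $$\underline a\|u\|_V^2\le\langle A(\theta)u,u\rangle_H\le\overline a\|u\|_V^2,\qquad \underline b\|u\|_H^2\le\langle B(\theta)u,u\rangle_H\le\overline b\|u\|_H^2;$$ (ii) (concavity and convexity) for every $u\in V$, the function $\theta\mapsto\langle A(\theta)u,u\rangle_H$ is concave in $D$ and the function $\theta\mapsto\langle B(\theta)u,u\rangle_H$ is convex in $D$; (iii) (smoothness) $\theta\mapsto A(\theta)$ and $\theta\mapsto B(\theta)$ are continuously (Fréchet) differentiable in $D$. Then the first eigenvalue $$\lambda_1(\theta)=\inf_{u\in V\setminus\{0\}}\frac{\langle A(\theta)u,u\rangle_H}{\langle B(\theta)u,u\rangle_H}$$ of the generalized eigenvalue problem $A(\theta)u=\lambda B(\theta)u$ is, as a function of $\theta$, pseudo-concave in $S$.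
   Context: $\mathscr{B}_s(V,V)$ (resp. $\mathscr{B}_s(H,H)$) is the space of bounded linear self-adjoint operators from $V$ (resp. $H$) to itself, with the operator norm. Expressions such as $\langle A(\theta)u,u\rangle_H$ are understood in the variational sense, i.e. as the value at $(u,u)$ of the bounded symmetric bilinear form on $V$ associated with the operator $A(\theta)$ (that is, $\langle A(\theta)u,v\rangle_H$ stands for the form on $V\times V$ represented by $A(\theta)\in\mathscr{B}_s(V,V)$ through the inner product of $V$); $\langle B(\theta)u,u\rangle_H$ is the usual inner product in $H$. A typical example is $V=H_0^1(\Omega)$, $H=L^2(\Omega)$ and $\langle A(\theta)u,u\rangle_H=\int_\Omega c(\theta)|\nabla u|^2dx$. Clarke subdifferential: for a Banach space $X$, an open set $D\subseteq X$, and a locally Lipschitz function $f:D\to\mathbb{R}$, the generalized directional derivative at $\theta\in D$ in direction $d\in X$ is $$f^\circ(\theta;d)=\limsup_{\theta'\to\theta,\ t\downarrow0}\frac{f(\theta'+td)-f(\theta')}{t},$$ and the Clarke subdifferential is $\partial f(\theta)=\{g\in X^*\mid f^\circ(\theta;d)\ge\langle g,d\rangle_{X^*,X}\ \text{for all } d\in X\}$. Pseudo-concavity: for $D\subseteq X$ open convex, a locally Lipschitz function $f:D\to\mathbb{R}$ is pseudo-concave in $D$ if for all $\theta,\theta'\in D$ and every $g\in\partial f(\theta)$, $$f(\theta)<f(\theta')\ \Rightarrow\ \langle g,\theta'-\theta\rangle_{X^*,X}>0.$$ For a convex set $S\subseteq X$, $f$ is pseudo-concave in $S$ if $f$ (on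 $S$) admits a locally Lipschitz extension $\widetilde f:\widetilde D\to\mathbb{R}$ to some open convex set $\widetilde D\supseteq S$ such that $\widetilde f$ is pseudo-concave in $\widetilde D$. *)

(* Defs.v *)
From HB Require Import structures.
From mathcomp Require Import all_boot all_order all_algebra.
From mathcomp Require Import all_classical all_reals all_analysis.

Set Implicit Arguments.
Unset Strict Implicit.
Unset Printing Implicit Defensive.

Import Order.TTheory GRing.Theory Num.Theory.
Import numFieldNormedType.Exports.

Local Open Scope classical_set_scope.
Local Open Scope ring_scope.

HB.mixin Record CompleteNormedModule_isHilbert (R : realType) V
    & CompleteNormedModule R V := {
  inner : V -> V -> R ;
  innerC : forall u v, inner u v = inner v u ;
  innerPl : forall (a : R) u v w,
    inner (a *: u + v) w = a * inner u w + inner v w ;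
  inner_norm : forall u, inner u u = `|u| ^+ 2
}.

#[short(type="hilbertType")]
HB.structure Definition Hilbert (R : realType) :=
  {V of CompleteNormedModule R V & CompleteNormedModule_isHilbert R V}.

Section inner_dot.
Context (R : realType) (V : hilbertType R).

Let inner_bilinear :
  bilinear_for (GRing.Scale.Law.clone _ _ *%R _)
               (GRing.Scale.Law.clone _ _ (idfun \; *%R) _)
               (inner : V -> V -> R).
Proof.
split=> [w a u v|w a u v] /=; first exact: innerPl.
by rewrite innerC innerPl !(innerC w).
Qed.

HB.instance Definition _ :=
  bilinear_isBilinear.Build R V V R *%R (idfun \; *%R) inner inner_bilinear.

Let inner_sym (u v : V) : inner u v = (-1) ^+ false * idfun (inner v u).
Proof. by rewrite expr0 mul1r innerC. Qed.

HB.instance Definition _ :=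
  isHermitianSesquilinear.Build R V false idfun inner inner_sym.

Let inner_gt0 (u : V) : u != 0 -> 0 < inner u u.
Proof. by move=> u0; rewrite inner_norm exprn_gt0// normr_gt0. Qed.

HB.instance Definition _ := isDotProduct.Build R V inner inner_gt0.

End inner_dot.

Section bounded_op.
Context (R : realType) (X Y : normedModType R).

Definition bounded_op_pred : {pred X -> Y} :=
  fun f => `[< linear f /\ continuous f >].

Record bounded_op := BoundedOp {
  bounded_op_fun :> X -> Y ;
  _ : bounded_op_fun \in bounded_op_pred
}.

HB.instance Definition _ := [isSub for bounded_op_fun].
HB.instance Definition _ := [Choice of bounded_op by <:].

Fact bounded_op_submod : submod_closed bounded_op_pred.
Proof.
split.
  apply/asboolP; split=> [a u v|x]; last exact: cvg_cst.
  by rewrite scaler0 addr0.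
move=> a f g /asboolP[lf cf] /asboolP[lg cg]; apply/asboolP; split.
  move=> b u v; rewrite /= !fctE lf lg !scalerDr !scalerA [b * a]mulrC.
  by rewrite addrACA.
by move=> x; apply: cvgD; [apply: cvgZl_tmp; exact: cf|exact: cg].
Qed.

HB.instance Definition _ :=
  GRing.isSubmodClosed.Build R (X -> Y) bounded_op_pred bounded_op_submod.
HB.instance Definition _ :=
  [SubChoice_isSubLmodule of bounded_op by <:].

Fact bounded_op_linear (f : bounded_op) : linear f.
Proof. by case: f => f /= /asboolP[]. Qed.

HB.instance Definition _ (f : bounded_op) :=
  GRing.isLinear.Build R X Y *:%R f (bounded_op_linear f).

Lemma bounded_op_continuous (f : bounded_op) : continuous f.
Proof. by case: f => f /= /asboolP[]. Qed.

Definition op_norm (f : bounded_op) : R :=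
  sup [set `|f x| | x in [set x : X | `|x| <= 1]].


Lemma op_norm_has_sup (f : bounded_op) :
  has_sup [set `|f x| | x in [set x : X | `|x| <= 1]].
Proof.
split; first by exists `|f 0|, 0 => //=; rewrite normr0.
have /bounded_funP/(_ 1)[M fM] : bounded_near f (nbhs (0 : X)).
  by apply/linear_bounded_continuous; exact: bounded_op_continuous.
by exists M => _ [x /= x1 <-]; exact: fM.
Qed.

Lemma op_norm_ub (f : bounded_op) x : `|f x| <= op_norm f * `|x|.
Proof.
have [->|x0] := eqVneq x 0; first by rewrite linear0 !normr0 mulr0.
rewrite -ler_pdivrMr ?normr_gt0//.
have -> : `|f x| / `|x| = `|f (`|x|^-1 *: x)|.
  by rewrite linearZ normrZ normfV normr_id mulrC.
apply: ub_le_sup; first by case: (op_norm_has_sup f).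
by exists (`|x|^-1 *: x) => //=; rewrite normrZ normfV normr_id mulVf ?normr_eq0.
Qed.

Lemma op_norm_le (f : bounded_op) (M : R) :
  (forall x, `|x| <= 1 -> `|f x| <= M) -> op_norm f <= M.
Proof.
move=> fM; apply: ge_sup; first by case: (op_norm_has_sup f).
by move=> _ [x /= x1 <-]; exact: fM.
Qed.

Lemma op_norm_ge0 (f : bounded_op) : 0 <= op_norm f.
Proof.
apply: ub_le_sup; first by case: (op_norm_has_sup f).
by exists 0; rewrite /= ?linear0 ?normr0.
Qed.

Fact ler_op_normD (f g : bounded_op) : op_norm (f + g) <= op_norm f + op_norm g.
Proof.
apply: op_norm_le => x x1; apply: le_trans (ler_normD (f x) (g x)) _.
by apply: lerD; apply: le_trans (op_norm_ub _ _) _; apply: ler_piMr => //;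
  exact: op_norm_ge0.
Qed.

Fact op_normZ (a : R) (f : bounded_op) : op_norm (a *: f) = `|a| * op_norm f.
Proof.
have le_opZ b h : op_norm (b *: h) <= `|b| * op_norm h.
  apply: op_norm_le => x x1; rewrite [X in `|X|](_ : _ = b *: h x)// normrZ.
  rewrite ler_wpM2l// (le_trans (op_norm_ub _ _))// ler_piMr//.
  exact: op_norm_ge0.
apply/eqP; rewrite eq_le le_opZ /=.
have [->|a0] := eqVneq a 0; first by rewrite normr0 mul0r op_norm_ge0.
rewrite -ler_pdivlMl ?normr_gt0// -normfV.
by rewrite -{1}(scale1r f) -(mulVf a0) -scalerA le_opZ.
Qed.

Fact op_norm_eq0 (f : bounded_op) : op_norm f = 0 -> f = 0.
Proof.
move=> f0; apply/val_inj/funext => x /=; apply/eqP.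
by rewrite -normr_le0 -(mul0r `|x|) -f0 op_norm_ub.
Qed.

HB.instance Definition _ :=
  Lmodule_isNormed.Build R bounded_op ler_op_normD op_normZ op_norm_eq0.

End bounded_op.

Section selfadjoint_op.
Context (R : realType) (V : hilbertType R).

Definition selfadjoint : {pred bounded_op V V} :=
  fun f => `[< forall u v, inner (f u) v = inner u (f v) >].

Record selfadjoint_op := SelfadjointOp {
  selfadjoint_op_val :> bounded_op V V ;
  _ : selfadjoint_op_val \in selfadjoint
}.

HB.instance Definition _ := [isSub for selfadjoint_op_val].
HB.instance Definition _ := [Choice of selfadjoint_op by <:].

Fact selfadjoint_submod : submod_closed selfadjoint.
Proof.
split.
  apply/asboolP => u v /=.
  by rewrite -[LHS]/(inner 0 v) -[RHS]/(inner u 0) linear0l linear0r.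
move=> a f g /asboolP sf /asboolP sg; apply/asboolP => u v.
rewrite -[LHS]/(inner (a *: f u + g u) v) -[RHS]/(inner u (a *: f v + g v)).
by rewrite [RHS]innerC !innerPl sf sg !(innerC u).
Qed.

HB.instance Definition _ :=
  GRing.isSubmodClosed.Build R (bounded_op V V) selfadjoint selfadjoint_submod.
HB.instance Definition _ :=
  [SubChoice_isSubLmodule of selfadjoint_op by <:].

Let sa_norm (f : selfadjoint_op) : R := `|val f|.

Let ler_sa_normD f g : sa_norm (f + g) <= sa_norm f + sa_norm g.
Proof. exact: ler_normD. Qed.

Let sa_normZ (a : R) f : sa_norm (a *: f) = `|a| * sa_norm f.
Proof. exact: normrZ. Qed.

Let sa_norm_eq0 f : sa_norm f = 0 -> f = 0.
Proof. by move=> /normr0_eq0 f0; exact/val_inj. Qed.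

HB.instance Definition _ :=
  Lmodule_isNormed.Build R selfadjoint_op ler_sa_normD sa_normZ sa_norm_eq0.

End selfadjoint_op.

Section embedding.
Context (R : realType) (V H : normedModType R).

Definition compact_operator (f : bounded_op V H) :=
  forall U : set V, bounded_set U -> precompact (f @` U).

Definition dense_compact_embedding (iota : bounded_op V H) :=
  [/\ injective iota, dense (range iota) & compact_operator iota].

End embedding.

Section differentiability.
Context (R : realType) (X Y : normedModType R).

(* Functions on an open set [D] are encoded as total functions; for [x] in an
   open [D], neither differentiability nor continuity at [x] depends on the
   values outside [D]. *)
Definition continuously_differentiable (D : set X) (F : X -> Y) :=
  exists2 dF : X -> bounded_op X Y,
    (forall x, D x -> is_diff x F (dF x)) &
    (forall x, D x -> {for x, continuous dF}).

End differentiability.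

Section pseudo_concavity.
Context (R : realType) (X : normedModType R).
Implicit Types (D S : set X) (f : X -> R) (x d : X).

Definition concave_function D f := convex_function D (fun x => - f x).

Definition locally_lipschitz D f := forall x, D x ->
  exists2 U, nbhs x U & [lipschitz f y | y in U `&` D].

(* Meant for [f] locally Lipschitz on a neighborhood of [x], where the limit
   superior is finite. *)
Definition clarke_derivative f x d : \bar R :=
  limf_esup (fun p : X * R => ((f (p.1 + p.2 *: d) - f p.1) / p.2)%:E)
    (filter_prod (nbhs x) (0 : R)^'+).

Definition clarke_subdifferential f x : set (bounded_op X R) :=
  [set g | forall d, ((g d)%:E <= clarke_derivative f x d)%E].

Definition pseudo_concave_open D f :=
  [/\ open D, convex_set D, locally_lipschitz D f &
    forall x y, D x -> D y ->
      forall g, clarke_subdifferential f x g -> f x < f y -> 0 < g (y - x)].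

(* Only the values of [f] on the convex set [S] matter. *)
Definition pseudo_concave S f :=
  exists (D' : set X) (f' : X -> R),
    [/\ S `<=` D', {in S, f' =1 f} & pseudo_concave_open D' f'].

End pseudo_concavity.

Section first_eigenvalue.
Context (R : realType) (V H : hilbertType R) (iota : bounded_op V H).

(* [V] is identified with a subspace of [H] through [iota]; the operator [a]
   stands for the bilinear form [inner (a u) v] on [V]. When [V] is trivial,
   the infimum is that of the empty set, which [inf] sends to [0]. *)
Definition first_eigenvalue (a : selfadjoint_op V) (b : selfadjoint_op H) : R :=
  inf [set inner (a u) u / inner (b (iota u)) (iota u) | u in [set u | u != 0]].

End first_eigenvalue.

(* Main.v *)
Require Import Defs.
From mathcomp Require Import all_boot all_order all_algebra.
From mathcomp Require Import all_classical all_reals all_analysis.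
From mathcomp Require Import ring lra.
Import Order.TTheory GRing.Theory Num.Theory.
Import numFieldNormedType.Exports.
Local Open Scope classical_set_scope.
Local Open Scope ring_scope.

(** The first eigenvalue is an infimum of ratios [a_i / b_i] of a nonnegative
    concave function and a positive convex function of [theta], where the index
    [i] runs over the nonzero vectors [u]. The two-sided ellipticity bounds
    make the values of [b_i] at any two points of [D] comparable, with a constant
    [kappa = bmax / bmin] that does not depend on [i]. Every such infimum [f] is
    pseudo-concave; the argument compares three aligned points and passes to the
    infimum over [i] afterwards.

    Fix [i] and let [mu] be the ratio [a_i / b_i] at [p]. As [mu >= 0], the
    function [q = a_i - mu b_i] is concave, and it vanishes at [p]. The point [p]
    lies between [p + t d] and [p - d], with weights proportional to [1] and [t],
    so [q (p + t d) <= - t * q (p - d)]. Since [q (p - d) >= (f (p - d) - mu) *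
    b_i (p - d)], a division by [b_i (p + t d)] bounds the ratio at [p + t d] in
    terms of [mu] and of [f (p - d)]; this is [ratio_step]. It is used twice.

    Using only [f (p - d) >= 0], it gives [f (p + t d) <= (1 + t kappa) f p]
    ([inf_ratio_growth]), which makes [f] locally bounded and then locally
    Lipschitz. If moreover [f (p - d) >= m > f p], it gives a decrease
    [f (p + t d) <= f p - t (m - f p) / kappa] ([inf_ratio_descent]).

    Now let [f x < f y] and [d = x - y]. For [p] near [x] the point [p - d] is
    near [y], so by continuity the decrease holds with a gap [m - f p] bounded
    below: the generalized directional derivative of [f] at [x] towards [x - y] is
    negative, hence [g (x - y) < 0] for every Clarke subgradient [g] at [x]. The
    ratios close to the infimum play the part of eigenvectors. *)

(** * Convexity along a line *)

(** [p] is the convex combination of [p + t *: d] and [p - d] with weights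
    [1 / (1 + t)] and [t / (1 + t)]; clearing the denominator yields a form that
    is linear in the values of [h]. *)
Lemma convex_function_between {R : realType} {X : normedModType R} {D : set X}
    {h : X -> R} {p d : X} {t : R} :
  convex_function D h -> 0 < t -> D (p - d) -> D (p + t *: d) ->
  (1 + t) * h p <= h (p + t *: d) + t * h (p - d).
Proof.
move=> hD t0 Dz Dy.
have s0 : 0 < 1 + t by rewrite addr_gt0.
have k01 : 0 <= (1 + t)^-1 <= 1.
  by rewrite invr_ge0 ltW//= invf_le1// lerDl ltW.
have := hD (Itv01 (andP k01).1 (andP k01).2) (p + t *: d) (p - d).
rewrite !inE => /(_ Dy Dz).
rewrite convRE /conv/= /unstable.onem.
have -> : 1 - (1 + t)^-1 = (1 + t)^-1 * t by field; rewrite gt_eqF.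
have -> : (1 + t)^-1 *: (p + t *: d) + ((1 + t)^-1 * t) *: (p - d) = p.
  rewrite -scalerA -scalerDr scalerBr addrACA addrN addr0.
  by rewrite -[X in X + t *: p]scale1r -scalerDl scalerA mulVf ?gt_eqF// scale1r.
by rewrite -mulrA -mulrDr ler_pdivlMl.
Qed.

(** * Infima of ratios of concave and convex functions *)

Section inf_of_ratios.
Context {R : realType} {X : normedModType R} {I : Type}.
Variables (J : set I) (D : set X) (a b : I -> X -> R) (kappa : R).
Hypotheses (kappa_gt0 : 0 < kappa) (D_open : open D).
Hypotheses (a_ge0 : forall i p, J i -> D p -> 0 <= a i p)
  (b_gt0 : forall i p, J i -> D p -> 0 < b i p)
  (b_comparable : forall i p q, J i -> D p -> D q -> b i p <= kappa * b i q)
  (a_concave : forall i, J i -> concave_function D (a i))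
  (b_convex : forall i, J i -> convex_function D (b i)).

Definition inf_ratio (p : X) : R := inf [set a i p / b i p | i in J].

Lemma inf_ratio_le {i p} : J i -> D p -> inf_ratio p <= a i p / b i p.
Proof.
move=> Ji Dp; apply: ge_inf; last by exists i.
by exists 0 => _ [j Jj <-]; rewrite divr_ge0 ?a_ge0 ?ltW ?b_gt0.
Qed.

Lemma inf_ratio_ge p (m : R) : J !=set0 ->
  (forall i, J i -> m <= a i p / b i p) ->
  m <= inf_ratio p.
Proof.
move=> [i Ji] mP; apply: lb_le_inf; first by exists (a i p / b i p), i.
by move=> _ [j Jj <-]; exact: mP.
Qed.

Lemma inf_ratio_set0 p : J = set0 -> inf_ratio p = 0.
Proof. by move=> J0; rewrite /inf_ratio J0 image_set0 inf0. Qed.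

Lemma inf_ratio_ge0 {p} : D p -> 0 <= inf_ratio p.
Proof.
move=> Dp; have [/inf_ratio_set0 ->//|/set0P J0] := eqVneq J set0.
by apply: inf_ratio_ge => // i Ji; rewrite divr_ge0 ?a_ge0 ?ltW ?b_gt0.
Qed.

(** The concave function [a i - mu * b i] vanishes at [p], so its value at
    [p + t *: d] is at most [- t] times its value at [p - d], where [a i] is
    bounded below by [inf_ratio (p - d) * b i (p - d)]. *)
Lemma ratio_step {i p d} {t : R} (mu := a i p / b i p) : J i -> 0 < t ->
  D p -> D (p - d) -> D (p + t *: d) ->
  a i (p + t *: d) / b i (p + t *: d) <=
  mu - t * (inf_ratio (p - d) - mu) * (b i (p - d) / b i (p + t *: d)).
Proof.
move=> Ji t0 Dp Dz Dy.
have mu0 : 0 <= mu by rewrite divr_ge0 ?a_ge0 ?ltW ?b_gt0.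
have bp := b_gt0 _ _ Ji Dp; have bz := b_gt0 _ _ Ji Dz.
have by_ := b_gt0 _ _ Ji Dy.
have ha := convex_function_between (a_concave _ Ji) t0 Dz Dy.
have hb := convex_function_between (b_convex _ Ji) t0 Dz Dy.
have hz : inf_ratio (p - d) * b i (p - d) <= a i (p - d).
  by rewrite -ler_pdivlMr// inf_ratio_le.
have hp : mu * b i p = a i p by rewrite divfK ?gt_eqF.
clearbody mu; rewrite ler_pdivrMr// mulrBl -!mulrA mulVf ?gt_eqF// mulr1.
have := ler_wpM2l mu0 hb; rewrite mulrCA hp => {}hb.
have := ler_wpM2l (ltW t0) hz.
lra.
Qed.

(** For [inf_ratio (p - d) >= 0], [ratio_step] bounds the [i]-th ratio at
    [p + t *: d] by [(1 + t * kappa)] times the [i]-th ratio at [p]. *)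
Lemma inf_ratio_growth {p d} {t : R} : 0 < t ->
  D p -> D (p - d) -> D (p + t *: d) ->
  inf_ratio (p + t *: d) <= (1 + t * kappa) * inf_ratio p.
Proof.
move=> t0 Dp Dz Dy.
have [J0|/set0P J0] := eqVneq J set0; first by rewrite !inf_ratio_set0// mulr0.
have s0 : 0 < 1 + t * kappa by rewrite addr_gt0// mulr_gt0.
rewrite mulrC -ler_pdivrMr//; apply: inf_ratio_ge => // i Ji.
rewrite ler_pdivrMr//; apply: (le_trans (inf_ratio_le Ji Dy)).
apply: (le_trans (ratio_step Ji t0 Dp Dz Dy)).
set mu := a i p / b i p; set r := b i (p - d) / _.
have mu0 : 0 <= mu by rewrite divr_ge0 ?a_ge0 ?ltW ?b_gt0.
have r0 : 0 <= r by rewrite divr_ge0 ?ltW ?b_gt0.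
have rk : r <= kappa by rewrite ler_pdivrMr ?b_gt0// b_comparable.
have f0 := inf_ratio_ge0 Dz.
have h1 : 0 <= t * inf_ratio (p - d) * r.
  by apply: mulr_ge0 => //; apply: mulr_ge0 => //; exact: ltW.
have h2 : t * mu * r <= t * mu * kappa by rewrite ler_wpM2l// mulr_ge0// ltW.
lra.
Qed.

(** An index [i] whose ratio at [p] exceeds [m] gives no decrease, but the
    infimum at [p] is already that over the indices with a ratio below [m]. *)
Lemma inf_ratio_descent {p d} {t m : R} : 0 < t ->
  D p -> D (p - d) -> D (p + t *: d) ->
  inf_ratio p < m -> m <= inf_ratio (p - d) ->
  inf_ratio (p + t *: d) <= inf_ratio p - t * (m - inf_ratio p) / kappa.
Proof.
move=> t0 Dp Dz Dy fm mf.
have [J0|/set0P[i0 Ji0]] := eqVneq J set0.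
  by move: (lt_le_trans fm mf); rewrite !inf_ratio_set0// ltxx.
(* The conclusion says that [l] is at most [inf_ratio p]; this form can be
   tested against one ratio [mu] at a time. *)
set l := (inf_ratio (p + t *: d) + t * m / kappa) / (1 + t / kappa).
have s0 : 0 < 1 + t / kappa by rewrite addr_gt0// divr_gt0.
suff : l <= inf_ratio p by rewrite ler_pdivrMr//; lra.
rewrite leNgt; apply/negP => fl.
have : inf_ratio p < Num.min l m by rewrite lt_min fl.
case/inf_lt; first by exists (a i0 p / b i0 p), i0.
move=> _ [i Ji <-]; rewrite lt_min => /andP[mul mum].
move: mul; apply/negP; rewrite -leNgt ler_pdivrMr//.
have := le_trans (inf_ratio_le Ji Dy) (ratio_step Ji t0 Dp Dz Dy).
set mu := a i p / b i p in mum *; set r := b i (p - d) / _ => fy.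
have rk : kappa^-1 <= r.
  by rewrite ler_pdivlMr ?b_gt0// mulrC ler_pdivrMr// mulrC b_comparable.
have h1 : t * (m - mu) * kappa^-1 <= t * (inf_ratio (p - d) - mu) * r.
  apply: ler_pM => //; [|by rewrite invr_ge0 ltW|].
    by rewrite mulr_ge0 ?subr_ge0 ?(ltW t0) ?(ltW mum).
  by rewrite ler_pM2l// lerD2r.
lra.
Qed.

(** * Local Lipschitz continuity *)

(** Two applications of [inf_ratio_growth]: with [t = 1] and starting from the
    centre [x] it bounds [inf_ratio] on a ball; between two points of that ball,
    with a step [d] of fixed length, the factor [t] is proportional to their
    distance. *)
Lemma inf_ratio_locally_lipschitz : locally_lipschitz D inf_ratio.
Proof.
move=> x Dx.
have /nbhs_ballP[r /= r0 rD] : nbhs x D by apply: open_nbhs_nbhs.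
have Dball y : `|y - x| < r -> D y.
  by move=> yx; apply: rD; rewrite -ball_normE /= distrC.
(* Half the radius, so that a step of length [s] back from a point of the ball
   of radius [s] stays in [D]. *)
have {}r0 : 0 < r / 2 by rewrite divr_gt0.
set s := r / 2 in r0; have rE : r = s + s by rewrite -splitr.
have near_x y : `|y - x| < s -> inf_ratio y <= (1 + kappa) * inf_ratio x.
  move=> yx; have sr : s < r by rewrite rE ltrDl.
  have -> : y = x + 1 *: (y - x) by rewrite scale1r subrKC.
  rewrite -[X in 1 + X]mul1r; apply: inf_ratio_growth => //.
    by apply: Dball; rewrite addrAC subrr add0r normrN (lt_trans yx).
  by rewrite scale1r subrKC; apply: Dball; rewrite (lt_trans yx).
set C := kappa * ((1 + kappa) * inf_ratio x) / s.
have one_sided y z : `|y - x| < s -> `|z - x| < s ->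
    inf_ratio z - inf_ratio y <= C * `|y - z|.
  move=> yx zx; have [->|yz] := eqVneq y z.
    by rewrite !subrr normr0 mulr0.
  have Dy : D y by apply: Dball; rewrite (lt_trans yx)// rE ltrDl.
  have Dz : D z by apply: Dball; rewrite (lt_trans zx)// rE ltrDl.
  have n0 : 0 < `|y - z| by rewrite normr_gt0 subr_eq0.
  set t := `|y - z| / s; have t0 : 0 < t by rewrite divr_gt0.
  set d := t^-1 *: (z - y).
  have zE : z = y + t *: d by rewrite scalerA mulfV ?gt_eqF// scale1r subrKC.
  have dE : `|d| = s.
    rewrite normrZ gtr0_norm ?invr_gt0// distrC /t invf_div divfK//.
    by rewrite gt_eqF.
  have Dyd : D (y - d).
    apply: Dball; rewrite addrAC (le_lt_trans (ler_normB _ _))// dE rE.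
    by rewrite ltrD2r.
  have := inf_ratio_growth t0 Dy Dyd; rewrite -zE => /(_ Dz) h.
  have h1 : t * kappa * inf_ratio y <= t * kappa * ((1 + kappa) * inf_ratio x).
    by rewrite ler_wpM2l ?near_x// mulr_ge0// ltW.
  have -> : C * `|y - z| = t * kappa * ((1 + kappa) * inf_ratio x).
    by rewrite /C /t; ring.
  lra.
exists (ball x s); first exact: nbhsx_ballx.
apply: (@klipschitzW _ _ _ C).
  apply: (@globally_properfilter _ _ (x, x)).
  by split => /=; split => //; exact: ballxx.
move=> [y z] /= [[+ _] [+ _]].
rewrite -ball_normE /= !(distrC x) => yx zx.
rewrite ler_norml lerNl opprB one_sided//= distrC one_sided//.
Qed.

Lemma inf_ratio_continuous {p} : D p -> {for p, continuous inf_ratio}.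
Proof.
move=> Dp; have [U Up] := inf_ratio_locally_lipschitz _ Dp.
case/pinfty_ex_gt0 => C C0 fC.
have UDp : nbhs p (U `&` D) by apply: filterI => //; apply: open_nbhs_nbhs.
apply/cvgrPdist_lt => e e0.
near=> q.
have : `|inf_ratio p - inf_ratio q| <= C * `|p - q|.
  by apply: (fC (p, q)); split => /=; [exact: nbhs_singleton UDp|near: q].
move=> /le_lt_trans; apply; rewrite mulrC -ltr_pdivlMr//.
near: q; rewrite -nbhs_nearE.
have := nbhsx_ballx p _ (divr_gt0 e0 C0); rewrite -ball_normE; exact.
Unshelve. all: by end_near. Qed.

(** * Pseudo-concavity *)

(** Near [x], [inf_ratio_descent] applies with [d = x - y], since [p - d] is then
    near [y]; it bounds all difference quotients by the same negative number. *)
Lemma inf_ratio_clarke_derivative_lt0 x y : D x -> D y ->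
  inf_ratio x < inf_ratio y ->
  (clarke_derivative inf_ratio x (x - y)%R < 0)%E.
Proof.
move=> Dx Dy fxy.
(* One third of the gap for the error at [x], one for the error at [y], and the
   last one remains as a uniform decrease. *)
set e := (inf_ratio y - inf_ratio x) / 3.
have e0 : 0 < e by rewrite divr_gt0// subr_gt0.
suff [W FW WP] : exists2 W, filter_prod (nbhs x) (0 : R)^'+ W &
    forall p, W p ->
      ((inf_ratio (p.1 + p.2 *: (x - y)) - inf_ratio p.1) / p.2
        <= - (e / kappa))%R.
  apply: (@le_lt_trans _ _ (- (e / kappa))%:E); last first.
    by rewrite lte_fin oppr_lt0 divr_gt0.
  apply: ge_ereal_inf; exists (ereal_sup [set
    ((inf_ratio (p.1 + p.2 *: (x - y)) - inf_ratio p.1) / p.2)%:E | p in W]).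
    by exists W.
  by apply: ge_ereal_sup => _ [p Wp <-]; rewrite lee_fin WP.
suff : \forall p \near filter_prod (nbhs x) (0 : R)^'+,
    [/\ 0 < p.2, D p.1, D (p.1 - (x - y)), D (p.1 + p.2 *: (x - y)) &
      inf_ratio p.1 + e <= inf_ratio (p.1 - (x - y))].
  move=> FW; eexists; first exact: FW.
  move=> [p t] /= [t0 Dp Dz Dq le]; rewrite ler_pdivrMr//.
  have := inf_ratio_descent t0 Dp Dz Dq _ le.
  rewrite ltrDl => /(_ e0).
  rewrite addrAC subrr add0r => h.
  by rewrite mulNr -mulrA [X in _ * X]mulrC mulrA [_ * t]mulrC; lra.
have cvg1 : p.1 @[p --> filter_prod (nbhs x) (0 : R)^'+] --> x by exact: cvg_fst.
have cvg0 : p.2 @[p --> filter_prod (nbhs x) (0 : R)^'+] --> (0 : R)^'+.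
  exact: cvg_snd.
have cvg2 : p.2 @[p --> filter_prod (nbhs x) (0 : R)^'+] --> (0 : R).
  apply: cvg_trans cvg0 _; exact: cvg_at_right_filter (@cvg_id _ _).
have cvgz : p.1 - (x - y) @[p --> filter_prod (nbhs x) (0 : R)^'+] --> y.
  rewrite [X in _ --> X](_ : y = x - (x - y)); last first.
    by rewrite opprB addrCA subrr addr0.
  exact: cvgB cvg1 (cvg_cst _).
have cvgq : p.1 + p.2 *: (x - y) @[p --> filter_prod (nbhs x) (0 : R)^'+] --> x.
  rewrite [X in _ --> X](_ : x = x + 0 *: (x - y)); last first.
    by rewrite scale0r addr0.
  by apply: cvgD => //; apply: cvgZr_tmp.
have nx : nbhs x D by apply: open_nbhs_nbhs.
have ny : nbhs y D by apply: open_nbhs_nbhs.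
have fx := cvg_comp _ _ cvg1 (inf_ratio_continuous Dx).
have fz := cvg_comp _ _ cvgz (inf_ratio_continuous Dy).
near=> p.
split.
- near: p; exact: cvg0 (nbhs_right_gt 0).
- near: p; exact: cvg1.
- near: p; exact: cvgz.
- near: p; exact: cvgq.
- have h1 : inf_ratio p.1 < inf_ratio x + e.
    by near: p; apply: (cvgr_lt (inf_ratio x)) => //; rewrite ltrDl.
  have h2 : inf_ratio y - e < inf_ratio (p.1 - (x - y)).
    by near: p; apply: (cvgr_gt (inf_ratio y)) => //; rewrite ltrBlDr ltrDl.
  have : inf_ratio y = inf_ratio x + 3 * e by rewrite /e mulrC divfK// subrKC.
  lra.
Unshelve. all: by end_near. Qed.

(** A subgradient [g] satisfies [g (x - y) <= f^o(x; x - y) < 0]; the sign change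
    turns this into the required inequality for [y - x]. *)
Lemma inf_ratio_pseudo_concave : convex_set D ->
  pseudo_concave_open D inf_ratio.
Proof.
move=> D_convex; split => //; first exact: inf_ratio_locally_lipschitz.
move=> x y Dx Dy g gx fxy.
have := le_lt_trans (gx (x - y))
  (inf_ratio_clarke_derivative_lt0 _ _ Dx Dy fxy).
by rewrite lte_fin -(opprB y x) linearN oppr_lt0.
Qed.
End inf_of_ratios.

Theorem theorem3 (R : realType) (V H : hilbertType R) (iota : bounded_op V H)
    (X : completeNormedModType R) (D S : set X)
    (A : X -> selfadjoint_op V) (B : X -> selfadjoint_op H)
    (amin amax bmin bmax : R) :
  dense_compact_embedding iota ->
  open D -> convex_set D ->
  S `<=` D -> S !=set0 -> convex_set S ->
  0 < amin -> amin < amax -> 0 < bmin -> bmin < bmax ->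
  (forall u theta, D theta ->
    amin * `|u| ^+ 2 <= inner (A theta u) u <= amax * `|u| ^+ 2 /\
    bmin * `|iota u| ^+ 2 <= inner (B theta (iota u)) (iota u)
      <= bmax * `|iota u| ^+ 2) ->
  (forall u, concave_function D (fun theta => inner (A theta u) u)) ->
  (forall u, convex_function D
    (fun theta => inner (B theta (iota u)) (iota u))) ->
  continuously_differentiable D A ->
  continuously_differentiable D B ->
  pseudo_concave S
    (fun theta => first_eigenvalue iota (A theta) (B theta)).
Proof.
move=> [iota_inj _ _] D_open D_convex SD _ _ amin0 _ bmin0 bminmax bounds.
move=> A_concave B_convex _ _.
have bmax0 : 0 < bmax by apply: lt_trans bminmax.
exists D, (fun theta => first_eigenvalue iota (A theta) (B theta)); split => //.
(* For a trivial [V] the index set is empty and the infimum is constantly [0],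
   a case that the results on infima of ratios include. *)
apply: (@inf_ratio_pseudo_concave _ _ _ [set u : V | u != 0] D
  (fun u theta => inner (A theta u) u)
  (fun u theta => inner (B theta (iota u)) (iota u)) (bmax / bmin)) => //.
- by rewrite divr_gt0.
- move=> u p _ /(bounds u)[/andP[+ _] _]; apply: le_trans.
  by rewrite mulr_ge0 ?sqr_ge0 ?(ltW amin0).
- move=> u p /= u0 /(bounds u)[_ /andP[+ _]]; apply: lt_le_trans.
  rewrite mulr_gt0// exprn_gt0// normr_gt0.
  by apply: contra_neq u0 => iu0; apply: iota_inj; rewrite linear0.
- move=> u p q _ /(bounds u)[_ /andP[_ Bp]] /(bounds u)[_ /andP[Bq _]].
  by rewrite (le_trans Bp)// -mulrA ler_pM2l// ler_pdivlMl.
Qed.
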